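(* Let $\mathbf{k}$ be a field, $U$ a $3$-dimensional $\mathbf{k}$-vector space with basis $x,y,z$, $U_0$ the span of $y,z$, $R=\operatorname{Sym}_\bullet U$, and $n$ a positive integer. Let $\Phi_{2n-1}\in D_{2n-1}U^*$ and assume that the $\mathbf{k}$-linear map $p:\operatorname{Sym}_{n-1}U\to D_{n-1}U^*$, $p(\mu_{n-1})=\mu_{n-1}(x(\Phi_{2n-1}))$, is an isomorphism. Let $I=\{\mu\in R\mid \mu(x(\Phi_{2n-1}))=0\}$. Let $B_0=B_3=R$, $B_1=(R\otimes D_{n-1}U_0^* )\oplus(R\otimes\operatorname{Sym}_nU_0)$, $B_2=(R\otimes\operatorname{Sym}_{n-1}U_0)\oplus(R\otimes D_nU_0^* )$ (tensor products over $\mathbf{k}$), and define $R$-linear maps, for $\mu_{0,i}\in\operatorname{Sym}_iU_0$ and $\nu_{0,i}\in D_iU_0^*$, by $$b_1(\nu_{0,n-1})=xp^{-1}(\nu_{0,n-1}),\qquad b_1(\mu_{0,n})=\mu_{0,n}-xp^{-1}(\mu_{0,n}(\Phi_{2n-1})),$$ $b_2(\mu_{0,n-1},0)$ has $R\otimes D_{n-1}U_0^*$-component $$x\sum_{m_1}\Big(\big(p^{-1}[(z\mu_{0,n-1})(\Phi_{2n-1})]\big)[(ym_1)(\Phi_{2n-1})]-\big(p^{-1}[(y\mu_{0,n-1})(\Phi_{2n-1})]\big)[(zm_1)(\Phi_{2n-1})]\Big)\otimes m_1^*$$ and $R\otimes\operatorname{Sym}_nU_0$-component $$x\sum_{m_2}\Big(\big(p^{-1}[(z\mu_{0,n-1})(\Phi_{2n-1})]\big)(y(m_2^*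 ))-\big(p^{-1}[(y\mu_{0,n-1})(\Phi_{2n-1})]\big)(z(m_2^* ))\Big)\otimes m_2+y\otimes z\mu_{0,n-1}-z\otimes y\mu_{0,n-1};$$ $b_2(0,\nu_{0,n})$ has $R\otimes D_{n-1}U_0^*$-component $$x\sum_{m_1}\Big(-\big(p^{-1}[(zm_1)(\Phi_{2n-1})]\big)(y(\nu_{0,n}))+\big(p^{-1}[(ym_1)(\Phi_{2n-1})]\big)(z(\nu_{0,n}))\Big)\otimes m_1^*-y\otimes z(\nu_{0,n})+z\otimes y(\nu_{0,n})$$ and $R\otimes\operatorname{Sym}_nU_0$-component $$x\sum_{m_2}\Big([p^{-1}(z(\nu_{0,n}))][y(m_2^* )]-[p^{-1}(y(\nu_{0,n}))][z(m_2^* )]\Big)\otimes m_2;$$ and $$b_3(1)=\Big(\sum_{m_1}b_1(m_1^* )\otimes m_1,\ \sum_{m_2}b_1(m_2)\otimes m_2^*\Big),$$ where $m_1$ ranges over the monomials of degree $n-1$ in $y,z$ and $m_2$ over the monomials of degree $n$ in $y,z$. Then $0\to B_3\xrightarrow{b_3}B_2\xrightarrow{b_2}B_1\xrightarrow{b_1}B_0$ is a minimal homogeneous resolution of $R/I$ by free $R$-modules, with graded form $0\to R(-2n-1)\to R(-n-1)^{2n+1}\to R(-n)^{2n+1}\to R$.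
   Context: $D_iV^*=\operatorname{Hom}_{\mathbf{k}}(\operatorname{Sym}_iV,\mathbf{k})$. $\operatorname{Sym}_\bullet U$ acts on $D_\bullet U^*=\bigoplus_iD_iU^*$: for $u\in\operatorname{Sym}_iU$, $w\in D_jU^*$, $u(w)\in D_{j-i}U^*$ is $v\mapsto w(vu)$ (zero if $i>j$); when $i=j$, $u(w)=w(u)\in\mathbf{k}$. For a monomial $m$ of degree $i$, $m^*$ denotes the dual basis element of $D_iU^*$ (with respect to the monomial basis). $D_iU_0^*$ is identified with the subspace of $D_iU^*$ spanned by the $m^*$ with $m$ a monomial in $y,z$ only; thus $p^{-1}$ may be applied to elements of $D_{n-1}U_0^*$. An expression $\mu(w)$ with $\mu\in\operatorname{Sym}_{n-1}U$ and $w\in D_{n-1}U^*$ is an element of $\mathbf{k}$. In $R\otimes\operatorname{Sym}_nU_0$ and $R\otimes D_{n-1}U_0^*$, $y\otimes(\cdot)$ and $z\otimes(\cdot)$ denote the linear forms $y,z\in R$ tensored with the indicated element. In the graded form, $B_1$ sits in degree $n$ and $B_2$ in degree $n+1$. *)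

(* Defs.v *)
From HB Require Import structures.
From mathcomp Require Import all_boot all_order all_algebra.
From mathcomp Require Import mpoly.
Set Implicit Arguments. Unset Strict Implicit. Unset Printing Implicit Defensive.
Import GRing.Theory.
Local Open Scope ring_scope.

(* Conventions.  U = k^3 with basis x,y,z = variables 0,1,2;
   R = Sym U = {mpoly k[3]}; Sym_i U = (i).-homog polynomials.
   D_i U^* : linear forms on Sym_i U, represented by their coordinates in the
   dual monomial basis, i.e. functions w : 'X_{1..3} -> k (an element of
   D_i U^* is such a function vanishing off the monomials of degree i;
   D_. U^* = all such functions).  The dual basis element m^* is [dualm m]. *)

Definition mon (a b c : nat) : 'X_{1..3} := [multinom [tuple a; b; c]].

Definition xm : 'X_{1..3} := mon 1 0 0.
Definition ym : 'X_{1..3} := mon 0 1 0.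
Definition zm : 'X_{1..3} := mon 0 0 1.

Definition m1 (n : nat) (a : 'I_n) : 'X_{1..3} := mon 0 a (n.-1 - a).
Definition m2 (n : nat) (b : 'I_n.+1) : 'X_{1..3} := mon 0 b (n - b).

Definition dualm (k : fieldType) (m : 'X_{1..3}) : 'X_{1..3} -> k :=
  fun v => if v == m then 1 else 0.

(* action of Sym U on D U^* : for a monomial u, u(w) = (v |-> w(v u)),
   extended linearly *)
Definition act (k : fieldType) (mu : {mpoly k[3]}) (w : 'X_{1..3} -> k)
  : 'X_{1..3} -> k :=
  fun v => \sum_(m <- msupp mu) mu@_m * w (v + m)%MM.

(* mu(w) in k when deg mu = deg w : the degree-0 coordinate of act mu w *)
Definition pairing (k : fieldType) (mu : {mpoly k[3]}) (w : 'X_{1..3} -> k) : k :=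
  act mu w mnm0.

Definition pmapx (k : fieldType) (Phi : 'X_{1..3} -> k) (mu : {mpoly k[3]}) :=
  act mu (act 'X_[xm] Phi).

Definition inD (k : fieldType) (i : nat) (w : 'X_{1..3} -> k) : Prop :=
  forall m, mdeg m != i -> w m = 0.

Definition inI (k : fieldType) (Phi : 'X_{1..3} -> k) (mu : {mpoly k[3]}) : Prop :=
  forall v, act mu (act 'X_[xm] Phi) v = 0.

Section Maps.
Variables (k : fieldType) (n : nat) (Phi : 'X_{1..3} -> k)
          (pinv : ('X_{1..3} -> k) -> {mpoly k[3]}).

Local Notation X := ('X_[xm] : {mpoly k[3]}).
Local Notation Y := ('X_[ym] : {mpoly k[3]}).
Local Notation Z := ('X_[zm] : {mpoly k[3]}).
Local Notation M1 a := ('X_[m1 a] : {mpoly k[3]}).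
Local Notation M2 b := ('X_[m2 b] : {mpoly k[3]}).
Local Notation D2 b := (dualm k (m2 b)).

(* Row-vector convention: a map B_i -> B_{i-1} is the matrix whose row e
   holds the coordinates of the image of the basis element e.
   Basis of B_1 : (m1_a^* in R (x) D_{n-1}U_0^*, then m2_b in R (x) Sym_n U_0).
   Basis of B_2 : (m1_a in R (x) Sym_{n-1}U_0, then m2_b^* in R (x) D_n U_0^* ). *)

Definition b1mx : 'M[{mpoly k[3]}]_(n + n.+1, 1) :=
  \matrix_(i, j) match split i with
    | inl a => X * pinv (dualm k (m1 a))
    | inr b => M2 b - X * pinv (act (M2 b) Phi)
    end.

Definition b2mx : 'M[{mpoly k[3]}]_(n + n.+1, n + n.+1) :=
  \matrix_(i, j) match split i, split j with
    | inl a, inl c =>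
        (pairing (pinv (act (Z * M1 a) Phi)) (act (Y * M1 c) Phi)
         - pairing (pinv (act (Y * M1 a) Phi)) (act (Z * M1 c) Phi)) *: X
    | inl a, inr b =>
        (pairing (pinv (act (Z * M1 a) Phi)) (act Y (D2 b))
         - pairing (pinv (act (Y * M1 a) Phi)) (act Z (D2 b))) *: X
        + (Z * M1 a)@_(m2 b) *: Y - (Y * M1 a)@_(m2 b) *: Z
    | inr b, inl c =>
        (- pairing (pinv (act (Z * M1 c) Phi)) (act Y (D2 b))
         + pairing (pinv (act (Y * M1 c) Phi)) (act Z (D2 b))) *: X
        - (act Z (D2 b) (m1 c)) *: Y + (act Y (D2 b) (m1 c)) *: Z
    | inr b, inr d =>
        (pairing (pinv (act Z (D2 b))) (act Y (D2 d))
         - pairing (pinv (act Y (D2 b))) (act Z (D2 d))) *: X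
    end.

(* b3(1) = (sum_{m1} b1(m1^* ) (x) m1, sum_{m2} b1(m2) (x) m2^* ) *)
Definition b3mx : 'M[{mpoly k[3]}]_(1, n + n.+1) :=
  \matrix_(i, j) b1mx j i.

End Maps.

Definition exact_at (R : comNzRingType) (a b c : nat)
  (A : 'M[R]_(a, b)) (B : 'M[R]_(b, c)) : Prop :=
  A *m B = 0 /\ forall v : 'rV[R]_b, v *m B = 0 -> exists w : 'rV[R]_a, v = w *m A.

Definition homog_mx (k : fieldType) (a b d : nat) (M : 'M[{mpoly k[3]}]_(a, b)) :=
  forall i j, M i j \is d.-homog.

(* minimality: all entries lie in the maximal homogeneous ideal (x,y,z) *)
Definition minimal_mx (k : fieldType) (a b : nat) (M : 'M[{mpoly k[3]}]_(a, b)) :=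
  forall i j, (M i j)@_mnm0 = 0.

(* Main.v *)
Require Import Defs.
From HB Require Import structures.
From mathcomp Require Import all_boot all_order all_algebra.
From mathcomp Require Import mpoly ring zify ssrcomplements.
From Stdlib Require Import FunctionalExtensionality.
Set Implicit Arguments. Unset Strict Implicit. Unset Printing Implicit Defensive.
Import GRing.Theory.
Local Open Scope ring_scope.

(** Write [Psi = x(Phi)].  A form [C] of degree [n] in [I] has explicit
    coordinates on the entries of [b1]: the values of [C(Phi)] on the monomials
    [m1] and the coefficients of [C] on the monomials [m2].  Each row of [b2] is
    [x] times such a coordinate vector plus a Koszul term, which gives
    [b1 b2 = 0]; the symmetry of [p] makes [b2] skew-symmetric, and [b3] is the
    transpose of [b1], so [b2 b3 = 0] too.

    A form of degree at least [n] is congruent modulo the image of [b1] to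
    [x^j h] with [h] of degree [n-1]; if it lies in [I] then [h(Psi)] is killed
    by [x^j], and [x^j p^-1(m^* )] is in the image when [x^j] does not divide
    [m].  Hence [I] is the image of [b1].

    Modulo [x] the complex splits into the Hilbert-Burch complex of [(y,z)^n]
    and its dual.  A cycle is therefore a boundary modulo [x], after one extra
    application of [Psi] at [B_1], where the dual complex is not exact;
    subtracting the boundary and dividing by [x] lowers the degree. *)

(** * Monomials in three variables *)

Lemma mon_surj (m : 'X_{1..3}) : exists a b c, m = mon a b c.
Proof.
exists (m (inord 0)), (m (inord 1)), (m (inord 2)).
apply/mnmP => i; rewrite [RHS](mnm_nth 0) /=.
by case: i => [[|[|[|?]]]] //= Hi; congr (m _); apply: val_inj; rewrite /= inordK.
Qed.

Lemma mon_eq a b c a' b' c' :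
  (mon a b c == mon a' b' c') = [&& a == a', b == b' & c == c'].
Proof.
apply/eqP/and3P => [e|[/eqP-> /eqP-> /eqP->]] //.
have e' i : nth 0%N (mon a b c) i = nth 0%N (mon a' b' c') i by rewrite e.
by move: (e' 0%N) (e' 1%N) (e' 2%N) => /= -> -> ->.
Qed.

Lemma mon_le a b c a' b' c' :
  (mon a b c <= mon a' b' c')%MM = [&& a <= a', b <= b' & c <= c']%N.
Proof.
apply/mnm_lepP/and3P => [H|[Ha Hb Hc] i]; last first.
  by rewrite !(mnm_nth 0); case: i => [[|[|[|?]]]].
by move: (H (inord 0)) (H (inord 1)) (H (inord 2)); rewrite !(mnm_nth 0) /= !inordK.
Qed.

Lemma mon_add a b c a' b' c' :
  (mon a b c + mon a' b' c')%MM = mon (a + a') (b + b') (c + c').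
Proof.
apply/mnmP => i; rewrite mnmDE !(mnm_nth 0) /=.
by case: i => [[|[|[|?]]]].
Qed.

Lemma mon_sub a b c a' b' c' :
  (mon a b c - mon a' b' c')%MM = mon (a - a') (b - b') (c - c').
Proof.
apply/mnmP => i; rewrite mnmBE !(mnm_nth 0) /=.
by case: i => [[|[|[|?]]]].
Qed.

Lemma mon0 : 0%MM = mon 0 0 0.
Proof.
apply/mnmP => i; rewrite mnm0E (mnm_nth 0) /=.
by case: i => [[|[|[|?]]]].
Qed.

Lemma mdeg_mon a b c : mdeg (mon a b c) = (a + b + c)%N.
Proof. by rewrite /mdeg /= !big_cons big_nil; lia. Qed.

(** * Coefficients, divisibility by monomials, and size of products *)

Section Action.
Variable k : fieldType.
Local Notation S := {mpoly k[3]}.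
Local Notation X := ('X_[xm] : S).
Local Notation Y := ('X_[ym] : S).
Local Notation Z := ('X_[zm] : S).
Implicit Types (f g h mu : S) (w : 'X_{1..3} -> k) (m v : 'X_{1..3}).

Lemma mpolyX_mon a b c : 'X_[mon a b c] = X ^+ a * Y ^+ b * Z ^+ c :> S.
Proof.
have E m j : ('X_[m] : S) ^+ j = 'X_[iter j (mnm_add m) 0%MM].
  by elim: j => [|j IH]; rewrite ?expr0 ?mpolyX0 // exprS IH -mpolyXD.
have I a' b' c' j : iter j (mnm_add (mon a' b' c')) 0%MM = mon (j * a') (j * b') (j * c').
  elim: j => [|j IH]; first by rewrite mon0.
  by rewrite iterS IH mon_add -!mulSn.
by rewrite !E !I -!mpolyXD !mon_add !muln0 !muln1 !addn0 !add0n.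
Qed.

Lemma mcoeffXM m f v : ('X_[m] * f)@_(m + v) = f@_v.
Proof. by rewrite mulrC mcoeffMX. Qed.

Lemma mcoeffXM_out m f v : ~~ (m <= v)%MM -> ('X_[m] * f)@_v = 0.
Proof.
move=> le; apply/eqP; rewrite mcoeff_eq0 mulrC; apply: contra le.
by rewrite (perm_mem (msuppMX _ _)) => /mapP[v' _ ->]; apply: lem_addr.
Qed.

Lemma mcoeffXM_if m f v : ('X_[m] * f)@_v = if (m <= v)%MM then f@_(v - m) else 0.
Proof.
case: ifP => mv; last by rewrite mcoeffXM_out ?mv.
by rewrite -{1}(submK mv) addmC mcoeffXM.
Qed.

(** Divisibility by a monomial is read off the support, so the quotient is written down term by
    term. *)
Lemma dvd_mpolyX m f : (forall v, ~~ (m <= v)%MM -> f@_v = 0) ->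
  exists g, f = 'X_[m] * g.
Proof.
move=> H; exists (\sum_(v <- msupp f) f@_v *: 'X_[v - m]).
rewrite {1}[f]mpolyE mulr_sumr big_seq [RHS]big_seq; apply: eq_bigr => v vf.
rewrite -scalerAr -mpolyXD addmC submK //.
by apply: contraLR vf => /H H0; rewrite mcoeff_msupp H0 eqxx.
Qed.

Lemma mpolyX_neq0 m : 'X_[m] != 0 :> S.
Proof. by rewrite -msupp_eq0 msuppX. Qed.

Lemma msize_mulX m f d : (msize ('X_[m] * f) <= d + mdeg m)%N = (msize f <= d)%N.
Proof.
have [->|f0] := eqVneq f 0; first by rewrite mulr0 msize0.
by rewrite msizeM ?mpolyX_neq0 // msizeX addSn /= addnC leq_add2r.
Qed.

Lemma msize_leD f g d : (msize f <= d -> msize g <= d -> msize (f + g) <= d)%N.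
Proof. by move=> hf hg; apply: leq_trans (msizeD_le _ _) _; rewrite geq_max hf. Qed.

Lemma msize_leB f g d : (msize f <= d -> msize g <= d -> msize (f - g) <= d)%N.
Proof. by move=> hf hg; apply: msize_leD; rewrite ?msizeN. Qed.

Lemma msize_le_sum I (r : seq I) (P : pred I) (F : I -> S) d :
  (forall i, P i -> (msize (F i) <= d)%N) -> (msize (\sum_(i <- r | P i) F i) <= d)%N.
Proof.
move=> H; apply: (big_ind (fun f => (msize f <= d)%N)) => //; first by rewrite msize0.
by move=> f g; apply: msize_leD.
Qed.

(** [msize] is the degree plus one, and 0 on the zero polynomial. Here [b] bounds the degree of [g],
    so multiplication by [g] adds at most [b] to the size. *)
Lemma msize_leM f g a b : (msize f <= a -> msize g <= b.+1 -> msize (f * g) <= a + b)%N.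
Proof.
move=> ha hb.
have [->|f0] := eqVneq f 0; first by rewrite mul0r msize0.
have [->|g0] := eqVneq g 0; first by rewrite mulr0 msize0.
rewrite msizeM //; move: (msize f) (msize g) ha hb => i j; lia.
Qed.

Lemma homog_msize_le d f : f \is d.-homog -> (msize f <= d.+1)%N.
Proof. by move=> /dhomogP H; rewrite msizeE; apply/bigmax_leqP_seq => m /H ->. Qed.

(** * The action of polynomials on inverse polynomials *)

(** The sum defining [act] runs over a support that varies with the polynomial. A common finite
    index set makes linearity a termwise matter. *)
Lemma actwE d mu w v : (msize mu <= d)%N ->
  act mu w v = \sum_(m : 'X_{1..3 < d}) mu@_m * w (v + m)%MM.
Proof.
move=> le; rewrite /act (big_mksub ('X_{1..3 < d} : subFinType _)) ?msupp_uniq //=; last first.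
  by move=> x /msize_mdeg_lt /leq_trans; apply.
by rewrite big_rmcond //= => i /memN_msupp_eq0 ->; rewrite mul0r.
Qed.

Lemma actD f g w : act (f + g) w = fun v => act f w v + act g w v.
Proof.
apply: functional_extensionality => v.
pose d := maxn (msize f) (msize g).
have fd : (msize f <= d)%N by rewrite leq_maxl.
have gd : (msize g <= d)%N by rewrite leq_maxr.
rewrite !(@actwE d) ?msize_leD //.
by rewrite -big_split /=; apply: eq_bigr => m _; rewrite mcoeffD mulrDl.
Qed.

Lemma actZ c f w : act (c *: f) w = fun v => c * act f w v.
Proof.
apply: functional_extensionality => v.
rewrite !(@actwE (msize f)) //; last exact: msizeZ_le.
by rewrite mulr_sumr; apply: eq_bigr => m _; rewrite mcoeffZ mulrA.
Qed.

Lemma act0 w : act 0 w = fun _ => 0.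
Proof. by apply: functional_extensionality => v; rewrite /act msupp0 big_nil. Qed.

Lemma actN f w : act (- f) w = fun v => - act f w v.
Proof.
rewrite -scaleN1r actZ; apply: functional_extensionality => v.
by rewrite mulN1r.
Qed.

Lemma actB f g w : act (f - g) w = fun v => act f w v - act g w v.
Proof. by rewrite actD actN. Qed.

Lemma act_sum I (r : seq I) (P : pred I) (F : I -> S) w :
  act (\sum_(i <- r | P i) F i) w = fun v => \sum_(i <- r | P i) act (F i) w v.
Proof.
apply: functional_extensionality => v.
by elim/big_rec2: _ => [|i a b _ IH]; rewrite ?act0 // actD IH.
Qed.

Lemma actX m w : act 'X_[m] w = fun v => w (v + m)%MM.
Proof.
apply: functional_extensionality => v.
by rewrite /act msuppX big_seq1 mcoeffX eqxx mul1r.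
Qed.

Lemma act0r f : act f (fun _ => 0) = fun _ => 0.
Proof.
by apply: functional_extensionality => v; rewrite /act big1 // => m _; rewrite mulr0.
Qed.

Lemma actM f g w : act (f * g) w = act f (act g w).
Proof.
apply: functional_extensionality => v.
rewrite {1}[f]mpolyE mulr_suml act_sum; apply: eq_bigr => m _.
rewrite -scalerAl actZ; congr (_ * _).
rewrite mulrC {1}[g]mpolyE mulr_suml act_sum; apply: eq_bigr => m' _.
by rewrite -scalerAl -mpolyXD actZ actX [(m' + _)%MM]addmC addmA.
Qed.

Lemma actC f g w : act f (act g w) = act g (act f w).
Proof. by rewrite -!actM mulrC. Qed.

Lemma act_inD d e f w : f \is d.-homog -> inD e w -> (d <= e)%N -> inD (e - d) (act f w).
Proof.
move=> /dhomogP hf hw le v hv; rewrite /act big_seq big1 // => m /hf dm.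
rewrite hw ?mulr0 //; apply: contra hv; rewrite mdegD dm => /eqP <-.
by rewrite addnK.
Qed.

Lemma dualm_inD m : inD (mdeg m) (dualm k m).
Proof. by move=> v; rewrite /dualm; case: (v =P m) => // ->; rewrite eqxx. Qed.

Lemma actX_dualm m v : act 'X_[m] (dualm k (v + m)) = dualm k v.
Proof. by rewrite actX; apply: functional_extensionality => u; rewrite /dualm eqm_add2r. Qed.

Lemma actX_dualm_out m v : ~~ (m <= v)%MM -> act 'X_[m] (dualm k v) = fun _ => 0.
Proof.
move=> H; rewrite actX; apply: functional_extensionality => u; rewrite /dualm.
by case: eqP H => // <-; rewrite lem_addl.
Qed.

Lemma act_dualm f m v : act f (dualm k m) v = if (v <= m)%MM then f@_(m - v) else 0.
Proof.
rewrite {1}[f]mpolyE act_sum.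
under eq_bigr do rewrite actZ actX /dualm.
case: ifP => H; last first.
  apply: big1 => u _; case: eqP => [e|]; last by rewrite mulr0.
  by rewrite -e lem_addr in H.
rewrite [in RHS](mpolyE f) raddf_sum /=; apply: eq_bigr => u _.
rewrite mcoeffZ mcoeffX -[u == _](eqm_add2l v) [(v + (m - v))%MM]addmC submK //.
by case: eqP.
Qed.
End Action.

(** * Coefficientwise constructions and coprime divisibility *)

Section HilbertBurch.
Variable k : fieldType.
Local Notation S := {mpoly k[3]}.
Local Notation X := ('X_[xm] : S).
Local Notation Y := ('X_[ym] : S).
Local Notation Z := ('X_[zm] : S).
Implicit Types (f g h mu : S) (w : 'X_{1..3} -> k) (m v : 'X_{1..3}).

Lemma msize_le_coef f d :
  (forall m, (d <= mdeg m)%N -> f@_m = 0) -> (msize f <= d)%N.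
Proof.
move=> H; rewrite msizeE; apply/bigmax_leqP_seq => m mf _.
rewrite ltnNge; apply: contraL mf => /H; rewrite mcoeff_msupp => ->.
by rewrite eqxx.
Qed.

Lemma mpoly_filter (P : pred 'X_{1..3}) f :
  {g : S | forall m, g@_m = if P m then f@_m else 0}.
Proof.
exists (\sum_(u <- msupp f | P u) f@_u *: 'X_[u]) => m.
rewrite raddf_sum /=.
under eq_bigr do rewrite mcoeffZ mcoeffX.
case: ifP => Pm.
  rewrite [in RHS](mpolyE f) raddf_sum /= [LHS]big_mkcond; apply: eq_bigr => u _.
  rewrite mcoeffZ mcoeffX; case: eqP => [->|]; first by rewrite Pm.
  by rewrite mulr0 if_same.
by rewrite big1 // => u Pu; case: eqP Pu => [->|]; rewrite ?Pm ?mulr0.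
Qed.

(** The hypothesis is coprimality of the two monomials. The coefficient of [f] at [v] is that of the
    common product at [m' + v], which vanishes unless [m] divides there. *)
Lemma dvd_coprime m m' f g : (forall v, (m <= m' + v)%MM -> (m <= v)%MM) ->
  'X_[m] * g = 'X_[m'] * f -> exists h, f = 'X_[m] * h.
Proof.
move=> H E; apply: dvd_mpolyX => v mv.
by rewrite -(mcoeffXM m') -E mcoeffXM_out //; apply: contra mv => /H.
Qed.

Lemma expX_mon a : X ^+ a = 'X_[mon a 0 0].
Proof. by rewrite (mpolyX_mon _ a 0 0) !expr0 !mulr1. Qed.

Lemma expY_mon b : Y ^+ b = 'X_[mon 0 b 0].
Proof. by rewrite (mpolyX_mon _ 0 b 0) !expr0 mulr1 mul1r. Qed.

Lemma expZ_mon c : Z ^+ c = 'X_[mon 0 0 c].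
Proof. by rewrite (mpolyX_mon _ 0 0 c) !expr0 !mul1r. Qed.

Lemma dvdZ_mulYn j f g : Z * g = Y ^+ j * f -> exists h, f = Z * h.
Proof.
rewrite expY_mon; apply: dvd_coprime => v.
by have [a [b [c ->]]] := mon_surj v; rewrite mon_add /zm !mon_le.
Qed.

Lemma msize_mulXY m f d : m \in [:: xm; ym; zm] ->
  (msize ('X_[m] * f) <= d.+1)%N = (msize f <= d)%N.
Proof.
move=> H; rewrite -(msize_mulX m f d); suff -> : mdeg m = 1%N by rewrite addn1.
by move: H; rewrite !inE => /or3P[] /eqP->; rewrite mdeg_mon.
Qed.

Lemma mul_mpolyX_inj m : injective ( *%R ('X_[m] : S)).
Proof. by apply: mulfI; apply: mpolyX_neq0. Qed.

(** * The Hilbert-Burch complex of [(y, z)^n] *)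

(** The convention that the entry of index -1 is 0, so that [Y * g b - Z * shift g b] also describes
    the first entry of the image under the Hilbert-Burch matrix. *)
Definition shift (g : nat -> S) (b : nat) : S := if b is b'.+1 then g b' else 0.

(** Injectivity of the Hilbert-Burch map: the matrix is bidiagonal with [Y] on the diagonal, so the
    entries vanish one after the other. *)
Lemma hb_inj n (g : nat -> S) :
  (forall b, (b <= n)%N -> Y * g b = Z * shift g b) ->
  forall b, (b <= n)%N -> g b = 0.
Proof.
move=> H; elim=> [|b IH] lb; apply: (@mul_mpolyX_inj ym); rewrite mulr0 H //= ?mulr0 //.
by rewrite IH ?mulr0 // ltnW.
Qed.

(** Kernel of the transposed matrix. In the inductive step the last relation reads
    [Z * f n.+1 = Y ^+ n.+1 * c'], so [Z] divides the scalar [c'] found so far, and the quotient is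
    the new scalar. *)
Lemma hb_dual_ker n (f : nat -> S) :
  (forall a, (a < n)%N -> Y * f a = Z * f a.+1) ->
  exists c, forall b, (b <= n)%N -> f b = c * (Y ^+ b * Z ^+ (n - b)).
Proof.
elim: n => [|n IH] H.
  by exists (f 0%N) => b; rewrite leqn0 => /eqP ->; rewrite !expr0 !mulr1.
have [c' Hc'] := IH (fun a la => H a (ltnW la)).
have E : Z * f n.+1 = Y ^+ n.+1 * c'.
  by rewrite -H // Hc' // subnn expr0 exprS; ring.
have [c Ec] := dvdZ_mulYn E; exists c => b; rewrite leq_eqVlt => /orP[/eqP->|lb].
  by apply: (@mul_mpolyX_inj zm); rewrite /= E Ec subnn expr0; ring.
by rewrite Hc' // subSn // exprS Ec; ring.
Qed.

(** Syzygies of the monomials of degree [n] in y and z. All terms but the last are divisible by [Z],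
    hence so is the last coefficient. The bound on [g] is one below that on [f]; this keeps the
    corrections in [ker_b1] within the size bound of the cycle. *)
Lemma hb_exact n d (f : nat -> S) :
  (forall b, (b <= n)%N -> (msize (f b) <= d.+1)%N) ->
  \sum_(b < n.+1) f b * (Y ^+ b * Z ^+ (n - b)) = 0 ->
  exists g : nat -> S, [/\ forall b, (msize (g b) <= d)%N,
    forall b, (n <= b)%N -> g b = 0
    & forall b, (b <= n)%N -> f b = Y * g b - Z * shift g b].
Proof.
elim: n f => [|n IH] f Hs E.
  exists (fun _ => 0); split=> // [b|b]; first by rewrite msize0.
  rewrite leqn0 => /eqP->; move: E; rewrite big_ord1 /= !expr0 !mulr1 => ->.
  by rewrite !mulr0 subr0.
move: E; rewrite big_ord_recr /= subnn expr0 mulr1.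
have -> : \sum_(b < n.+1) f b * (Y ^+ b * Z ^+ (n.+1 - b))
        = Z * \sum_(b < n.+1) f b * (Y ^+ b * Z ^+ (n - b)).
  rewrite mulr_sumr; apply: eq_bigr => b _; rewrite subSn 1?exprS ?leq_ord //; ring.
set s := \sum_(b < _) _ => E.
have [e Ee] : exists h, f n.+1 = Z * h.
  apply: (@dvdZ_mulYn n.+1 _ (- s)).
  by apply/eqP; rewrite mulrN eq_sym -addr_eq0 addrC [Y ^+ _ * _]mulrC; apply/eqP.
have se : s + e * Y ^+ n.+1 = 0.
  by apply: (@mul_mpolyX_inj zm); rewrite /= mulr0 -E Ee; ring.
have se' : (msize e <= d)%N by rewrite -(@msize_mulXY zm) -?Ee ?Hs // !inE eqxx ?orbT.
(* As [Z * e * Y ^+ n.+1] is [Y * e] times the preceding monomial, the last term is absorbed into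
   entry [n]. The new entry of [g] at [n] must then be [- e]. *)
pose f' b := if b == n then f n + Y * e else f b.
have [||g [g1 g2 g3]] := IH f'.
- move=> b lb; rewrite /f'; case: eqP => _; last by apply: Hs; apply: leq_trans lb _.
  by apply: msize_leD; rewrite ?Hs // msize_mulXY // !inE eqxx ?orbT.
- rewrite -[RHS]se /s !big_ord_recr /= /f' eqxx subnn expr0 exprS.
  under eq_bigr => b _ do rewrite (ltn_eqF (ltn_ord b)).
  by ring.
exists (fun b => if b == n then - e else g b); split=> [b|b lb|b].
- by case: ifP => _; rewrite ?msizeN ?g1.
- by rewrite g2 1?ltnW // gtn_eqF.
rewrite leq_eqVlt => /orP[/eqP->|lb].
  by rewrite Ee (gtn_eqF (ltnSn n)) /= eqxx g2 //; ring.
have -> : shift (fun b0 => if b0 == n then - e else g b0) b = shift g b.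
  by case: b lb => //= b lb; rewrite ltn_eqF.
have := g3 _ lb; rewrite /f'; case: eqP => [->|//].
rewrite g2 // => E'; apply: (addIr (Y * e)); rewrite E'; ring.
Qed.

(** The transposed map is not onto. For [f a = Y * g a - Z * g a.+1] the weighted sum telescopes to
    [Y ^+ n * g 0 - Z ^+ n * g n], so membership in the ideal of y^n and z^n is necessary. It also
    suffices: [g 0] is taken to be [w0] and the other entries are found successively. *)
Lemma hb_dual_solve n d (f : nat -> S) (w0 wn : S) :
  (forall a, (a < n)%N -> (msize (f a) <= d.+1)%N) ->
  (msize w0 <= d)%N -> (msize wn <= d)%N ->
  \sum_(a < n) f a * (Y ^+ (n - a.+1) * Z ^+ a) = Y ^+ n * w0 - Z ^+ n * wn ->
  exists g : nat -> S, [/\ forall b, (msize (g b) <= d)%N, g 0%N = w0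
    & forall a, (a < n)%N -> f a = Y * g a - Z * g a.+1].
Proof.
elim: n f w0 => [|n IH] f w0 Hs s0 sn.
  by exists (fun _ => w0).
rewrite big_ord_recl /= subSS subn0 expr0 mulr1.
have -> : \sum_(i < n) f (lift ord0 i) * (Y ^+ (n.+1 - (lift ord0 i).+1) * Z ^+ (lift ord0 i))
  = Z * \sum_(i < n) f i.+1 * (Y ^+ (n - i.+1) * Z ^+ i).
  rewrite mulr_sumr; apply: eq_bigr => i _; rewrite lift0 subSS exprS; ring.
set s := \sum_(i < n) _ => E.
(* The quotient [e] is the value forced on [g 1]. *)
have [e Ee] : exists h, Y * w0 - f 0%N = Z * h.
  apply: (@dvdZ_mulYn n _ (s + Z ^+ n * wn)).
  transitivity (f 0%N * Y ^+ n + Z * s + Z ^+ n.+1 * wn - f 0%N * Y ^+ n); first by rewrite exprS; ring.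
  by rewrite E exprS; ring.
have se : (msize e <= d)%N.
  rewrite -(@msize_mulXY zm) -?Ee ?inE ?eqxx ?orbT //.
  by apply: msize_leB; rewrite ?Hs // msize_mulXY // !inE eqxx ?orbT.
have [|//|//||g [g1 g2 g3]] := IH (fun a => f a.+1) e.
- by move=> a la; apply: Hs.
- apply: (@mul_mpolyX_inj zm); rewrite /= -/s.
  have -> : Z * (Y ^+ n * e - Z ^+ n * wn) = Y ^+ n * (Z * e) - Z ^+ n.+1 * wn by rewrite exprS; ring.
  rewrite -Ee; have -> : Z * s = (f 0%N * Y ^+ n + Z * s) - f 0%N * Y ^+ n by ring.
  by rewrite E exprS; ring.
exists (fun b => if b is b'.+1 then g b' else w0); split=> // [[|b]|[|a]] //.
  by move=> _; rewrite g2 -Ee; ring.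
exact: g3.
Qed.

(** The terms with y-exponent at least [n] form [Y ^+ n * w0]; every remaining term has z-exponent
    at least [n]. *)
Lemma split_yz n d f : (msize f <= d + n)%N ->
  (forall a b c, (b < n)%N -> (c < n)%N -> f@_(mon a b c) = 0) ->
  exists w0 wn : S, [/\ (msize w0 <= d)%N, (msize wn <= d)%N & f = Y ^+ n * w0 - Z ^+ n * wn].
Proof.
move=> sf H; have [f1 Hf1] := mpoly_filter (fun m => mon 0 n 0 <= m)%MM f.
have [w0 E0] : exists g, f1 = 'X_[mon 0 n 0] * g.
  by apply: dvd_mpolyX => v /negPf mv; rewrite Hf1 mv.
have [wn En] : exists g, f1 - f = 'X_[mon 0 0 n] * g.
  apply: dvd_mpolyX => v; have [a [b [c ->]]] := mon_surj v; rewrite mcoeffB Hf1 !mon_le /=.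
  rewrite andbT -ltnNge => nc; case: leqP => [|nb]; first by rewrite subrr.
  by rewrite H // subrr.
have s1 : (msize f1 <= d + n)%N.
  apply: leq_trans sf; apply: msize_le_coef => m lm; rewrite Hf1.
  by rewrite (memN_msupp_eq0 (msize_mdeg_ge lm)) if_same.
exists w0, wn; split.
- by rewrite -(msize_mulX (mon 0 n 0)) -E0 mdeg_mon add0n addn0.
- by rewrite -(msize_mulX (mon 0 0 n)) -En mdeg_mon !add0n msize_leB.
- by rewrite expY_mon expZ_mon -E0 -En; ring.
Qed.

(** * Reduction modulo x *)

(** Reduction modulo x is an endomorphism of the same ring, the substitution x = 0, so a residue is
    already its own lift. *)
Definition modx f : S := f \mPo [tuple 0; Y; Z].

HB.instance Definition _ := GRing.RMorphism.copy modx (comp_mpoly [tuple 0; Y; Z]).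
HB.instance Definition _ := GRing.Linear.copy modx (comp_mpoly [tuple 0; Y; Z]).

Lemma modx_mon a b c : modx 'X_[mon a b c] = if a == 0%N then 'X_[mon a b c] else 0.
Proof.
rewrite /modx comp_mpolyX !big_ord_recl big_ord0 mulr1 !(mnm_nth 0) /= expr0n (mpolyX_mon _ a b c).
by case: a => [|a] /=; rewrite ?mul0r // expr0 !mul1r.
Qed.

Lemma modxX : modx X = 0. Proof. by rewrite modx_mon. Qed.
Lemma modxY : modx Y = Y. Proof. by rewrite modx_mon. Qed.
Lemma modxZ : modx Z = Z. Proof. by rewrite modx_mon. Qed.

Lemma mcoeff_modx f a b c :
  (modx f)@_(mon a b c) = if a == 0%N then f@_(mon a b c) else 0.
Proof.
elim/mpolyind: f => [|e m f _ _ IH]; first by rewrite raddf0 !mcoeff0 if_same.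
rewrite raddfD /= linearZ /= !mcoeffD IH !mcoeffZ.
have [a' [b' [c' ->]]] := mon_surj m; rewrite modx_mon (fun_if (mcoeff _)) mcoeff0 !mcoeffX mon_eq.
case: (a =P 0%N) => [->|/eqP a0]; first by case: a' => //=; rewrite mulr0.
by case: (a' =P 0%N) => [->|_]; rewrite 1?(eq_sym 0%N a) 1?(negPf a0) /= mulr0 addr0.
Qed.

Lemma modx_id f : modx (modx f) = modx f.
Proof.
apply/mpolyP => m; have [a [b [c ->]]] := mon_surj m.
by rewrite !mcoeff_modx; case: eqP.
Qed.

Lemma modx_eq0 f : modx f = 0 -> exists g, f = X * g.
Proof.
move=> H; apply: dvd_mpolyX => v; have [a [b [c ->]]] := mon_surj v.
rewrite mon_le !andbT -eqn0Ngt => a0.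
by have := mcoeff_modx f a b c; rewrite H mcoeff0 a0.
Qed.

Lemma msize_modx f d : (msize f <= d)%N -> (msize (modx f) <= d)%N.
Proof.
move=> sf; apply: msize_le_coef => m lm; have lm' := leq_trans sf lm.
have := memN_msupp_eq0 (msize_mdeg_ge lm').
have [a [b [c ->]]] := mon_surj m.
by rewrite mcoeff_modx => ->; rewrite if_same.
Qed.
End HilbertBurch.

(** * Homogeneous forms and the monomials of degree n-1 and n in y, z *)

Lemma homog_coefP (k : fieldType) d (f : {mpoly k[3]}) :
  reflect (forall m, mdeg m != d -> f@_m = 0) (f \is d.-homog).
Proof.
apply: (iffP idP) => [hf m|H]; first exact: dhomog_nemf_coeff.
apply/dhomogP => m; rewrite mcoeff_msupp; apply: contraNeq => /H ->; by rewrite eqxx.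
Qed.

Lemma homog_divX (k : fieldType) d m (f : {mpoly k[3]}) :
  'X_[m] * f \is (d + mdeg m).-homog -> f \is d.-homog.
Proof.
move=> /homog_coefP H; apply/homog_coefP => v dv.
by rewrite -(mcoeffXM m) H // mdegD addnC eqn_add2r.
Qed.

(** In terms of indices, [ord_lo] is multiplication of [m1 a] by z and [ord_hi] is multiplication by
    y. *)
Definition ord_lo n (a : 'I_n) : 'I_n.+1 := widen_ord (leqnSn n) a.
Definition ord_hi n (a : 'I_n) : 'I_n.+1 := lift ord0 a.

Lemma m1_lo n (a : 'I_n) : (zm + m1 a)%MM = m2 (ord_lo a).
Proof.
apply/eqP; rewrite mon_add mon_eq /=.
by case: n a => [[]//|n] a /=; have := ltn_ord a; lia.
Qed.

Lemma m1_hi n (a : 'I_n) : (ym + m1 a)%MM = m2 (ord_hi a).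
Proof.
apply/eqP; rewrite mon_add mon_eq [nat_of_ord (ord_hi a)]lift0 add1n eqxx /=.
by case: n a => [[]//|n] a /=; have := ltn_ord a; lia.
Qed.

Lemma m2_eq n (b b' : 'I_n.+1) : (m2 b == m2 b') = (b == b').
Proof.
rewrite mon_eq /=; apply/andP/idP => [[]//|/eqP->]; by rewrite !eqxx.
Qed.

Lemma m1_eq n (b b' : 'I_n) : (m1 b == m1 b') = (b == b').
Proof.
rewrite mon_eq /=; apply/andP/idP => [[]//|/eqP->]; by rewrite !eqxx.
Qed.

Lemma mdeg_m2 n (b : 'I_n.+1) : mdeg (m2 b) = n.
Proof. by rewrite mdeg_mon; have := ltn_ord b; lia. Qed.

Lemma mdeg_m1 n (a : 'I_n) : mdeg (m1 a) = n.-1.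
Proof. by rewrite mdeg_mon; have := ltn_ord a; lia. Qed.

(** * The isomorphism p and its inverse *)

Section Main.
Variables (k : fieldType) (n : nat) (Phi : 'X_{1..3} -> k)
  (pinv : ('X_{1..3} -> k) -> {mpoly k[3]}).
Hypothesis n_gt0 : (0 < n)%N.
Hypothesis Phi_deg : inD (2 * n - 1) Phi.
Hypothesis pinvK : forall mu, mu \is (n.-1).-homog -> pinv (pmapx Phi mu) = mu.
Hypothesis pinvP :
  forall w, inD n.-1 w -> pinv w \is (n.-1).-homog /\ pmapx Phi (pinv w) =1 w.
Local Notation S := {mpoly k[3]}.
Local Notation X := ('X_[xm] : S).
Local Notation Y := ('X_[ym] : S).
Local Notation Z := ('X_[zm] : S).
Implicit Types (f g h mu C : S) (w u E : 'X_{1..3} -> k) (m v : 'X_{1..3}).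
Implicit Types (a c : 'I_n) (b d : 'I_n.+1).

Local Notation Psi := (act X Phi).
Local Notation zero := (fun _ : 'X_{1..3} => 0 : k).
Local Notation D1 a := (dualm k (m1 a)).
Local Notation D2 b := (dualm k (m2 b)).
Local Notation M1 a := ('X_[m1 a] : S).
Local Notation M2 b := ('X_[m2 b] : S).

Lemma homogX : X \is 1.-homog. Proof. by rewrite dhomogX /= mdeg_mon. Qed.
Lemma homogY : Y \is 1.-homog. Proof. by rewrite dhomogX /= mdeg_mon. Qed.
Lemma homogZ : Z \is 1.-homog. Proof. by rewrite dhomogX /= mdeg_mon. Qed.

Lemma homog_mulX m f : m \in [:: xm; ym; zm] -> f \is n.-1.-homog -> 'X_[m] * f \is n.-homog.
Proof.
move=> hm hf; have e : n = (1 + n.-1)%N by rewrite add1n prednK.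
rewrite {}e; apply: dhomogM => //.
by move: hm; rewrite !inE => /or3P[] /eqP->; rewrite dhomogX /= mdeg_mon.
Qed.

Lemma Psi_deg : inD (2 * n - 2) Psi.
Proof.
have -> : (2 * n - 2)%N = (2 * n - 1 - 1)%N by lia.
by apply: act_inD homogX Phi_deg _; lia.
Qed.

Lemma p_inj f g : f \is n.-1.-homog -> g \is n.-1.-homog ->
  act f Psi = act g Psi -> f = g.
Proof. by move=> hf hg e; rewrite -(pinvK hf) -(pinvK hg) /pmapx e. Qed.

Lemma pinv_homog w : inD n.-1 w -> pinv w \is n.-1.-homog.
Proof. by move=> /pinvP[]. Qed.

Lemma act_pinv w : inD n.-1 w -> act (pinv w) Psi = w.
Proof. by move=> /pinvP[_ H]; apply: functional_extensionality. Qed.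

Lemma inI_eq f : inI Phi f <-> act f Psi = zero.
Proof. by split=> [H|H v]; [apply: functional_extensionality|rewrite H]. Qed.

Lemma act_Phi_inD m : mdeg m = n -> inD n.-1 (act 'X_[m] Phi).
Proof.
move=> dm; have -> : n.-1 = (2 * n - 1 - n)%N by lia.
by apply: act_inD => //; rewrite ?dhomogX /= ?dm //; lia.
Qed.

Lemma act_dual_inD m v : mdeg m = 1%N -> mdeg v = n -> inD n.-1 (act 'X_[m] (dualm k v)).
Proof.
move=> dm dv; rewrite -subn1 -dv; apply: act_inD; rewrite ?dhomogX /= ?dm ?dv //.
by rewrite -dv; apply: dualm_inD.
Qed.

Lemma D1_inD a : inD n.-1 (D1 a).
Proof. by rewrite -(mdeg_m1 a); apply: dualm_inD. Qed.

(** Symmetry of p: both sides equal the value of [pinv u * pinv w] on [Psi], because the action is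
    commutative. *)
Lemma pairing_pinvC u w : inD n.-1 u -> inD n.-1 w ->
  pairing (pinv u) w = pairing (pinv w) u.
Proof.
move=> hu hw; rewrite /pairing -{1}(act_pinv hw) -{2}(act_pinv hu).
by rewrite actC.
Qed.

Lemma pairing_actX f g m : pairing f (act (g * 'X_[m]) Phi) = act (g * f) Phi m.
Proof.
rewrite /pairing -actM; have -> : f * (g * 'X_[m]) = 'X_[m] * (g * f) by ring.
by rewrite actM actX add0m.
Qed.

Lemma pairing_dual f g m : pairing f (act g (dualm k m)) = (g * f)@_m.
Proof.
rewrite /pairing -actM act_dualm subm0 mulrC.
by rewrite -{1}[m]add0m lem_addr.
Qed.

(** An element killed by x vanishes on every multiple of x, so only the dual monomials in y and z
    occur. *)
Lemma D0_expand E : inD n.-1 E -> act X E = zero ->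
  E = fun v => \sum_(a < n) E (m1 a) * D1 a v.
Proof.
move=> hE xE; apply: functional_extensionality => v.
have [i [j [l ev]]] := mon_surj v.
have [|dv] := boolP (mdeg v == n.-1); last first.
  rewrite hE // big1 // => a _; rewrite /dualm; case: (v =P m1 a) dv => [->|]; last by rewrite mulr0.
  by rewrite mdeg_m1 eqxx.
case: i ev => [|i] ev dv; last first.
  have := congr1 (@^~ (mon i j l)) xE; rewrite actX mon_add addn1 !addn0 -ev => ->.
  rewrite big1 // => a _; rewrite /dualm ev mon_eq /=; by rewrite mulr0.
have jn : (j < n)%N by move: dv; rewrite ev mdeg_mon; lia.
have e : v = m1 (Ordinal jn).
  by apply/eqP; move: dv; rewrite ev mdeg_mon mon_eq /=; lia.
rewrite (bigD1 (Ordinal jn)) //= big1 => [|a na]; rewrite /dualm e.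
  by rewrite eqxx mulr1 addr0.
by rewrite m1_eq eq_sym (negPf na) mulr0.
Qed.

Lemma pinv_D0 E : inD n.-1 E -> act X E = zero ->
  pinv E = \sum_(a < n) E (m1 a) *: pinv (D1 a).
Proof.
move=> hE xE; apply: p_inj; first exact: pinv_homog.
  by apply: rpred_sum => a _; apply: rpredZ; apply: pinv_homog; apply: D1_inD.
rewrite act_pinv // {1}(D0_expand hE xE) act_sum; apply: functional_extensionality => v.
by apply: eq_bigr => a _; rewrite actZ act_pinv //; apply: D1_inD.
Qed.

Lemma homog_split C : C \is n.-homog ->
  exists2 C', C' \is n.-1.-homog & C = \sum_(b < n.+1) C@_(m2 b) *: M2 b + X * C'.
Proof.
move=> hC; pose C0 := \sum_(b < n.+1) C@_(m2 b) *: M2 b.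
have h0 : C0 \is n.-homog.
  by apply: rpred_sum => b _; apply: rpredZ; rewrite dhomogX /= mdeg_m2.
have [C' E] : exists g, C - C0 = X * g.
  apply: dvd_mpolyX => v; have [i [j [l ev]]] := mon_surj v.
  rewrite {1}ev mon_le !andbT -eqn0Ngt => /eqP i0; move: ev; rewrite {}i0 => ev.
  have [dv|dv] := boolP (mdeg v == n); last first.
    by apply: dhomog_nemf_coeff dv; apply: rpredB.
  have jn : (j < n.+1)%N by move: dv; rewrite ev mdeg_mon; lia.
  have e : v = m2 (Ordinal jn).
    by apply/eqP; move: dv; rewrite ev mdeg_mon mon_eq /=; lia.
  rewrite mcoeffB raddf_sum /= (bigD1 (Ordinal jn)) //= big1 => [|b nb].
    by rewrite mcoeffZ mcoeffX e eqxx mulr1 addr0 subrr.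
  by rewrite mcoeffZ mcoeffX e m2_eq (negPf nb) mulr0.
exists C'; last by rewrite -E addrC subrK.
apply: (@homog_divX _ _ xm); rewrite mdeg_mon !addn0 addn1 prednK // -E.
exact: rpredB.
Qed.

(** * Generators in degree n, their syzygies, and the vanishing compositions *)

Definition gen1 a : S := X * pinv (D1 a).
Definition gen2 b : S := M2 b - X * pinv (act (M2 b) Phi).

(** Write [C = C0 + X * C'] with [C0] free of x. Since x kills [C(Phi)], [pinv_D0] applies to it;
    and [p(C') = C(Phi) - C0(Phi)] determines [C']. *)
Lemma I_coord C : C \is n.-homog -> act C Psi = zero ->
  C = \sum_(a < n) act C Phi (m1 a) *: gen1 a + \sum_(b < n.+1) C@_(m2 b) *: gen2 b.
Proof.
move=> hC IC; have [C' hC' EC] := homog_split hC.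
have dE : inD n.-1 (act C Phi).
  have -> : n.-1 = (2 * n - 1 - n)%N by lia.
  by apply: act_inD => //; lia.
have xE : act X (act C Phi) = zero by rewrite actC.
have EC' : C' = pinv (act C Phi) - \sum_(b < n.+1) C@_(m2 b) *: pinv (act (M2 b) Phi).
  apply: p_inj => //.
    apply: rpredB; first exact: pinv_homog.
    by apply: rpred_sum => b _; apply: rpredZ; apply/pinv_homog/act_Phi_inD/mdeg_m2.
  rewrite actB act_pinv // act_sum -actM mulrC.
  have -> : X * C' = C - \sum_(b < n.+1) C@_(m2 b) *: M2 b by rewrite {1}EC addrC addKr.
  rewrite actB act_sum; apply: functional_extensionality => v; congr (_ - _).
  by apply: eq_bigr => b _; rewrite !actZ act_pinv //; apply/act_Phi_inD/mdeg_m2.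
rewrite {1}EC EC' pinv_D0 // mulrBr !mulr_sumr addrC -addrA; congr (_ + _).
  by apply: eq_bigr => a _; rewrite scalerAr.
rewrite addrC -sumrB; apply: eq_bigr => b _.
by rewrite -scalerAr -scalerBr.
Qed.

(** Forms of degree [n] in I whose coordinates in the sense of [I_coord] are the coefficients of x
    in the rows of [b2]. *)
Definition syz1 a : S :=
  Y * pinv (act (M2 (ord_lo a)) Phi) - Z * pinv (act (M2 (ord_hi a)) Phi).
Definition syz2 b : S := Y * pinv (act Z (D2 b)) - Z * pinv (act Y (D2 b)).

Local Notation b1 := (b1mx n Phi pinv).
Local Notation b2 := (b2mx n Phi pinv).
Local Notation b3 := (b3mx n Phi pinv).

Lemma split_l a : split (lshift n.+1 a) = inl a.
Proof. exact: (unsplitK (inl a)). Qed.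

Lemma split_r b : split (rshift n b) = inr b.
Proof. exact: (unsplitK (inr b)). Qed.

Lemma b1_l a j : b1 (lshift _ a) j = gen1 a.
Proof. by rewrite mxE split_l. Qed.

Lemma b1_r b j : b1 (rshift _ b) j = gen2 b.
Proof. by rewrite mxE split_r. Qed.

Lemma mulZM1 a : Z * M1 a = M2 (ord_lo a).
Proof. by rewrite -mpolyXD m1_lo. Qed.

Lemma mulYM1 a : Y * M1 a = M2 (ord_hi a).
Proof. by rewrite -mpolyXD m1_hi. Qed.

Lemma actZD2 b a : act Z (D2 b) (m1 a) = (ord_lo a == b)%:R.
Proof. by rewrite actX /dualm addmC m1_lo m2_eq; case: eqP. Qed.

Lemma actYD2 b a : act Y (D2 b) (m1 a) = (ord_hi a == b)%:R.
Proof. by rewrite actX /dualm addmC m1_hi m2_eq; case: eqP. Qed.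

Lemma b2_ll a c : b2 (lshift _ a) (lshift _ c) = act (syz1 a) Phi (m1 c) *: X.
Proof.
rewrite mxE !split_l !pairing_actX mulZM1 mulYM1 /syz1 actB.
by [].
Qed.

Lemma b2_lr a b : b2 (lshift _ a) (rshift _ b) =
  (syz1 a)@_(m2 b) *: X + (ord_lo a == b)%:R *: Y - (ord_hi a == b)%:R *: Z.
Proof.
rewrite mxE split_l split_r !pairing_dual mulZM1 mulYM1 !mcoeffX !m2_eq /syz1 mcoeffB.
by [].
Qed.

Lemma D2_inD b : inD n.-1 (act Y (D2 b)) /\ inD n.-1 (act Z (D2 b)).
Proof. by split; apply: act_dual_inD; rewrite ?mdeg_m2 // mdeg_mon. Qed.

Lemma act_M2_inD b : inD n.-1 (act (M2 b) Phi).
Proof. by apply: act_Phi_inD => //; apply: mdeg_m2. Qed.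

Lemma b2_rl b c : b2 (rshift _ b) (lshift _ c) =
  act (syz2 b) Phi (m1 c) *: X - (ord_lo c == b)%:R *: Y + (ord_hi c == b)%:R *: Z.
Proof.
have [hY hZ] := D2_inD b.
rewrite mxE split_l split_r actZD2 actYD2.
rewrite (pairing_pinvC _ hY) ?(pairing_pinvC _ hZ) // ?mulZM1 ?mulYM1; try exact: act_M2_inD.
by rewrite -mulZM1 -mulYM1 !pairing_actX /syz2 actB [- _ + _]addrC.
Qed.

Lemma b2_rr b d : b2 (rshift _ b) (rshift _ d) = (syz2 b)@_(m2 d) *: X.
Proof. by rewrite mxE !split_r !pairing_dual /syz2 mcoeffB. Qed.

(** The coefficients of x are antisymmetrised values of the symmetric pairing of [pairing_pinvC], or
    opposite numbers in the mixed blocks; the Koszul terms of the mixed blocks have opposite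
    signs. *)
Lemma b2_skew : b2^T = - b2.
Proof.
apply/matrixP => i j; rewrite !mxE.
case: (split i) (split j) => [a|b] [c|d].
- rewrite (@pairing_pinvC (act (Z * M1 c) Phi)) ?(@pairing_pinvC (act (Y * M1 c) Phi));
    rewrite ?mulZM1 ?mulYM1; try exact: act_M2_inD.
  by rewrite -scaleNr opprB.
- rewrite !pairing_dual !actZD2 !actYD2 !mulZM1 !mulYM1 !mcoeffX !m2_eq -!mul_mpolyC.
  by ring.
- rewrite !pairing_dual !actZD2 !actYD2 !mulZM1 !mulYM1 !mcoeffX !m2_eq -!mul_mpolyC.
  by ring.
have [hY hZ] := D2_inD b; have [hY' hZ'] := D2_inD d.
by rewrite (pairing_pinvC hZ' hY) (pairing_pinvC hY' hZ) -scaleNr opprB.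
Qed.

Lemma sum_delta_lo (F : 'I_n.+1 -> S) a : \sum_b (ord_lo a == b)%:R *: F b = F (ord_lo a).
Proof.
rewrite (bigD1 (ord_lo a)) //= eqxx scale1r big1 ?addr0 // => b nb.
by rewrite eq_sym (negPf nb) scale0r.
Qed.

Lemma sum_delta_hi (F : 'I_n.+1 -> S) a : \sum_b (ord_hi a == b)%:R *: F b = F (ord_hi a).
Proof.
rewrite (bigD1 (ord_hi a)) //= eqxx scale1r big1 ?addr0 // => b nb.
by rewrite eq_sym (negPf nb) scale0r.
Qed.

Lemma syz1_homog a : syz1 a \is n.-homog.
Proof.
by apply: rpredB; apply: homog_mulX; rewrite ?inE ?eqxx ?orbT //;
  apply: pinv_homog => //; apply: act_M2_inD.
Qed.

Lemma syz2_homog b : syz2 b \is n.-homog.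
Proof.
have [hY hZ] := D2_inD b.
by apply: rpredB; apply: homog_mulX; rewrite ?inE ?eqxx ?orbT //; apply: pinv_homog.
Qed.

Lemma syz1_I a : act (syz1 a) Psi = zero.
Proof.
rewrite actB !actM !act_pinv //; try exact: act_M2_inD.
rewrite -mulZM1 -mulYM1 -!actM !mulrA [Z * Y]mulrC.
by apply: functional_extensionality => v; rewrite subrr.
Qed.

Lemma syz2_I b : act (syz2 b) Psi = zero.
Proof.
have [hY hZ] := D2_inD b.
rewrite actB !actM !act_pinv // [act Z (act Y _)]actC.
by apply: functional_extensionality => v; rewrite subrr.
Qed.

Lemma XD2 b f : act X (act f (D2 b)) = zero.
Proof.
rewrite actC actX_dualm_out ?act0r //.
by rewrite mon_le.
Qed.

Lemma b2_b1 : b2 *m b1 = 0.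
Proof.
apply/matrixP => i j; rewrite !mxE big_split_ord /=.
under eq_bigr do rewrite b1_l.
under [X in _ + X]eq_bigr do rewrite b1_r.
rewrite -(splitK i); case: (split i) => [a|b] /=.
  under eq_bigr do rewrite b2_ll.
  under [X in _ + X]eq_bigr do rewrite b2_lr.
  have e b : ((syz1 a)@_(m2 b) *: X + (ord_lo a == b)%:R *: Y - (ord_hi a == b)%:R *: Z) * gen2 b
    = X * ((syz1 a)@_(m2 b) *: gen2 b) + Y * ((ord_lo a == b)%:R *: gen2 b)
      - Z * ((ord_hi a == b)%:R *: gen2 b).
    by rewrite mulrBl mulrDl -!scalerAl -!scalerAr.
  under [X in _ + X]eq_bigr do rewrite e.
  rewrite sumrB big_split /= -!mulr_sumr sum_delta_lo sum_delta_hi.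
  under eq_bigr do rewrite -scalerAl scalerAr.
  rewrite -mulr_sumr.
  (* The bracket is [syz1 a] by [I_coord]. Its multiple by x cancels the x-parts of the two
     generators, and the monomial parts cancel because y z m1 is reached in two ways. *)
  transitivity (X * (\sum_(c < n) act (syz1 a) Phi (m1 c) *: gen1 c
    + \sum_(d < n.+1) (syz1 a)@_(m2 d) *: gen2 d) + Y * gen2 (ord_lo a) - Z * gen2 (ord_hi a)).
    by ring.
  rewrite -I_coord ?syz1_I ?syz1_homog // /gen2 -mulZM1 -mulYM1 /syz1 -mulZM1 -mulYM1; ring.
under [X in _ + X]eq_bigr do rewrite b2_rr.
under eq_bigr do rewrite b2_rl.
have e c : (act (syz2 b) Phi (m1 c) *: X - (ord_lo c == b)%:R *: Y + (ord_hi c == b)%:R *: Z) * gen1 c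
  = X * (act (syz2 b) Phi (m1 c) *: gen1 c)
    - Y * (X * (act Z (D2 b) (m1 c) *: pinv (D1 c)))
    + Z * (X * (act Y (D2 b) (m1 c) *: pinv (D1 c))).
  by rewrite mulrDl mulrBl actZD2 actYD2 -!scalerAl -!scalerAr.
under eq_bigr do rewrite e.
under [X in _ + X]eq_bigr do rewrite -scalerAl scalerAr.
have [hY hZ] := D2_inD b.
rewrite big_split sumrB /= -!mulr_sumr -!pinv_D0 ?XD2 //.
transitivity (X * (\sum_(a < n) act (syz2 b) Phi (m1 a) *: gen1 a
  + \sum_(d < n.+1) (syz2 b)@_(m2 d) *: gen2 d) - Y * (X * pinv (act Z (D2 b)))
  + Z * (X * pinv (act Y (D2 b)))); first by ring.
by rewrite -I_coord ?syz2_I ?syz2_homog // /syz2; ring.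
Qed.

Lemma b3E : b3 = b1^T.
Proof. by apply/matrixP => i j; rewrite !mxE. Qed.

Lemma b3_b2 : b3 *m b2 = 0.
Proof.
apply: (can_inj (@trmxK _ _ _)); rewrite trmx_mul b3E trmxK b2_skew mulNmx b2_b1.
by rewrite trmx0 oppr0.
Qed.

(** * The image of [b1] *)

Definition inJ f := exists v : 'rV[S]_(n + n.+1), f = (v *m b1) 0 0.

Lemma inJD f g : inJ f -> inJ g -> inJ (f + g).
Proof. by move=> [v ->] [w ->]; exists (v + w); rewrite mulmxDl [RHS]mxE. Qed.

Lemma inJM f g : inJ g -> inJ (f * g).
Proof. by move=> [v ->]; exists (f *: v); rewrite -scalemxAl [RHS]mxE. Qed.

Lemma inJZ (e : k) f : inJ f -> inJ (e *: f).
Proof. by rewrite -mul_mpolyC; apply: inJM. Qed.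

Lemma inJ0 : inJ 0.
Proof. by exists 0; rewrite mul0mx mxE. Qed.

Lemma inJ_sum I (r : seq I) (P : pred I) (F : I -> S) :
  (forall i, P i -> inJ (F i)) -> inJ (\sum_(i <- r | P i) F i).
Proof. by move=> H; apply: big_ind => //; [apply: inJ0|apply: inJD]. Qed.

Lemma inJ_b1 i : inJ (b1 i 0).
Proof. by exists (delta_mx 0 i); rewrite -rowE [RHS]mxE. Qed.

Lemma inJ_gen1 a : inJ (gen1 a).
Proof. by rewrite -(b1_l a 0); apply: inJ_b1. Qed.

Lemma inJ_gen2 b : inJ (gen2 b).
Proof. by rewrite -(b1_r b 0); apply: inJ_b1. Qed.

Lemma act_gen1 a : act (gen1 a) Psi = zero.
Proof.
rewrite actM act_pinv ?actX_dualm_out //; last exact: D1_inD.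
by rewrite mon_le.
Qed.

Lemma act_gen2 b : act (gen2 b) Psi = zero.
Proof.
rewrite actB !actM act_pinv; last exact: act_M2_inD.
by rewrite actC; apply: functional_extensionality => v; rewrite subrr.
Qed.

Lemma inJ_I f : inJ f -> act f Psi = zero.
Proof.
move=> [v ->]; rewrite mxE act_sum; apply: functional_extensionality => u.
apply: big1 => i _; rewrite actM -(splitK i); case: (split i) => j.
  by rewrite /= b1_l act_gen1 act0r.
by rewrite /= b1_r act_gen2 act0r.
Qed.

Lemma In_inJ C : C \is n.-homog -> act C Psi = zero -> inJ C.
Proof.
move=> hC IC; rewrite (I_coord hC IC).
by apply: inJD; apply: inJ_sum => i _; apply: inJZ; [apply: inJ_gen1|apply: inJ_gen2].
Qed.

(* Trades a factor x of p^-1(m^* ) for a factor y until m is free of x: with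
   W = m y, x p^-1(y(W^* )) - y p^-1(x(W^* )) lies in I_n. *)
Lemma inJ_Xn_dual j m : mdeg m = n.-1 -> (forall v, m != (mon j 0 0 + v)%MM) ->
  inJ (X ^+ j * pinv (dualm k m)).
Proof.
elim: j m => [|j IH] m dm H; first by have := H m; rewrite -mon0 add0m eqxx.
have [e [b [c em]]] := mon_surj m.
case: e em => [|e] em.
  have bn : (b < n)%N by move: dm; rewrite em mdeg_mon; lia.
  have -> : m = m1 (Ordinal bn).
    by apply/eqP; move: dm; rewrite em mdeg_mon mon_eq /=; lia.
  by rewrite exprSr -mulrA; apply/inJM/inJ_gen1.
pose u := mon e b.+1 c; pose W := mon e.+1 b.+1 c.
have dW : mdeg W = n by move: dm; rewrite em !mdeg_mon; lia.
have du : mdeg u = n.-1 by move: dm; rewrite em !mdeg_mon; lia.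
have eY : act Y (dualm k W) = dualm k m.
  by rewrite -(actX_dualm k ym m); congr (act _ (dualm k _)); rewrite em mon_add !addn0 addn1.
have eX : act X (dualm k W) = dualm k u.
  by rewrite -(actX_dualm k xm u); congr (act _ (dualm k _)); rewrite mon_add !addn0 addn1.
have hm : inD n.-1 (dualm k m) by rewrite -dm; apply: dualm_inD.
have hu : inD n.-1 (dualm k u) by rewrite -du; apply: dualm_inD.
have -> : X ^+ j.+1 * pinv (dualm k m) =
  X ^+ j * (X * pinv (dualm k m) - Y * pinv (dualm k u)) + Y * (X ^+ j * pinv (dualm k u)).
  by rewrite exprSr; ring.
apply: inJD; last first.
  apply: inJM; apply: IH => // v; have [a' [b' [c' ->]]] := mon_surj v.
  have := H (mon a' b c'); rewrite em !mon_add !mon_eq; lia.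
apply/inJM/In_inJ.
  by apply: rpredB; apply: homog_mulX; rewrite ?inE ?eqxx ?orbT //; apply: pinv_homog.
rewrite actB !actM !act_pinv // -eX -eY [act X (act Y _)]actC.
by apply: functional_extensionality => v; rewrite subrr.
Qed.

(** The index type of monomials of degree below [n] only provides finiteness; it contains all
    monomials of degree [n.-1]. *)
Lemma pinv_expand w : inD n.-1 w ->
  pinv w = \sum_(m : 'X_{1..3 < n} | mdeg m == n.-1) w m *: pinv (dualm k m).
Proof.
move=> hw; apply: p_inj; first exact: pinv_homog.
  apply: rpred_sum => m /eqP dm; apply: rpredZ; apply: pinv_homog.
  by rewrite -dm; apply: dualm_inD.
rewrite act_pinv // act_sum; apply: functional_extensionality => v.
have e (m : 'X_{1..3 < n}) : mdeg m == n.-1 ->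
  act (w m *: pinv (dualm k m)) Psi v = if (m : 'X_{1..3}) == v then w v else 0.
  move=> /eqP dm; rewrite actZ act_pinv; last by rewrite -dm; apply: dualm_inD.
  by rewrite /dualm eq_sym; case: eqP => [->|]; rewrite ?mulr1 ?mulr0.
rewrite (eq_bigr _ e).
have [dv|dv] := boolP (mdeg v == n.-1); last by rewrite hw // big1 // => m _; rewrite if_same.
have vn : (mdeg v < n)%N by rewrite (eqP dv) prednK.
rewrite (bigD1 (BMultinom vn)) //= eqxx big1 ?addr0 // => m /andP[_ nm].
by rewrite ifN.
Qed.

(** Monomials divisible by x are already of the required form. Any other monomial of degree at least
    [n] is a multiple of some [m2 b], and [gen2 b] trades it for a multiple of x. *)
Lemma reduce_step (d : nat) f : (n <= d)%N -> f \is d.-homog ->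
  exists2 h, h \is d.-1.-homog & inJ (f - X * h).
Proof.
move=> nd /dhomogP hf.
rewrite [f]mpolyE big_seq.
apply: (big_ind (fun f : S => exists2 h, h \is d.-1.-homog & inJ (f - X * h))).
- by exists 0; rewrite ?rpred0 // mulr0 subr0; apply: inJ0.
- move=> f1 f2 [h1 H1 J1] [h2 H2 J2]; exists (h1 + h2); first exact: rpredD.
  have -> : f1 + f2 - X * (h1 + h2) = f1 - X * h1 + (f2 - X * h2) by ring.
  exact: inJD.
move=> m mf; have dm := hf _ mf.
suff [h hh Jh] : exists2 h, h \is d.-1.-homog & inJ ('X_[m] - X * h).
  exists (f@_m *: h); first exact: rpredZ.
  by rewrite -scalerAr -scalerBr; apply: inJZ.
have [e [i [j em]]] := mon_surj m; move: dm; rewrite {}em {mf} /= mdeg_mon => dm.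
case: e dm => [|e] dm; last first.
  exists 'X_[mon e i j]; first by rewrite dhomogX /= mdeg_mon -dm.
  by rewrite -mpolyXD mon_add add1n !add0n subrr; apply: inJ0.
(* Taking as much of y as possible, up to [n], leaves at most [j] factors z to complete a divisor of
   degree [n]. *)
have bn : (minn i n < n.+1)%N by lia.
pose b := Ordinal bn; pose r : S := 'X_[mon 0 (i - b) (j - (n - b))].
have er : 'X_[mon 0 i j] = r * M2 b.
  by rewrite -mpolyXD mon_add; congr 'X_[_]; apply/eqP; rewrite mon_eq /=; lia.
exists (r * pinv (act (M2 b) Phi)).
  have -> : d.-1 = (d - n + n.-1)%N by lia.
  apply: dhomogM; last by apply: pinv_homog; apply: act_M2_inD.
  by rewrite dhomogX /= mdeg_mon /=; lia.
have -> : 'X_[mon 0 i j] - X * (r * pinv (act (M2 b) Phi)) = r * gen2 b.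
  by rewrite er /gen2; ring.
exact/inJM/inJ_gen2.
Qed.

Lemma reduce j f : f \is (n.-1 + j).-homog ->
  exists2 h, h \is n.-1.-homog & inJ (f - X ^+ j * h).
Proof.
elim: j f => [|j IH] f hf.
  by exists f; rewrite addn0 // expr0 mul1r subrr in hf *; apply: inJ0.
have [|g hg Jg] := reduce_step _ hf; first by lia.
have [|h hh Jh] := IH g; first by move: hg; rewrite addnS.
exists h => //.
have -> : f - X ^+ j.+1 * h = f - X * g + X * (g - X ^+ j * h) by rewrite exprS; ring.
by apply/inJD/inJM.
Qed.

Lemma homog_I_inJ (d : nat) f : f \is d.-homog -> act f Psi = zero -> inJ f.
Proof.
move=> hf If; have [nd|dn] := leqP n.-1 d; last first.
  suff -> : f = 0 by apply: inJ0.
  (* Below degree [n.-1] the ideal is zero: a power of x moves [f] to degree [n.-1], where p is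
     injective. *)
  have : X ^+ (n.-1 - d) * f = 0.
    apply: p_inj; rewrite ?rpred0 //; last by rewrite act0 actM If act0r.
    set e := (n.-1 - d)%N; have -> : n.-1 = (1 * e + d)%N by rewrite /e; lia.
    by apply: dhomogM => //; apply/dhomogMn/homogX.
  by move/eqP; rewrite mulf_eq0 expf_eq0 (negPf (mpolyX_neq0 _ _)) andbF /= => /eqP.
have [|h hh Jh] := @reduce (d - n.-1) f; first by rewrite subnKC.
set j := (d - n.-1)%N in Jh.
have -> : f = f - X ^+ j * h + X ^+ j * h by rewrite subrK.
apply: inJD => //.
have Ih : act (X ^+ j) (act h Psi) = zero.
  rewrite -actM; have -> : X ^+ j * h = f - (f - X ^+ j * h) by rewrite subKr.
  by rewrite actB If (inJ_I Jh); apply: functional_extensionality => v; rewrite subrr.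
have hw : inD n.-1 (act h Psi).
  have {1}-> : n.-1 = (2 * n - 2 - n.-1)%N by lia.
  by apply: act_inD => //; [apply: Psi_deg|lia].
have -> : h = pinv (act h Psi) by rewrite pinvK.
rewrite pinv_expand // mulr_sumr; apply: inJ_sum => m /eqP dm.
rewrite -scalerAr.
(* If x^j divides [m], the coefficient at [m] is a value of [X ^+ j] acting on [h(Psi)], hence 0;
   otherwise [inJ_Xn_dual] applies. *)
have [jm|jm] := boolP (mon j 0 0 <= m)%MM; last first.
  by apply/inJZ/inJ_Xn_dual => // v; apply: contraNneq jm => ->; apply: lem_addr.
have := congr1 (@^~ (m - mon j 0 0)%MM) Ih; rewrite expX_mon actX submK // => ->.
by rewrite scale0r; apply: inJ0.
Qed.

(** I is a homogeneous ideal because [Psi] lives in the single degree 2n-2: at a given [v] only one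
    homogeneous component of [f] can contribute. *)
Lemma inI_inJ f : inI Phi f <-> inJ f.
Proof.
rewrite inI_eq; split; last exact: inJ_I.
move=> If; rewrite (@pihomog_partitionE _ _ mdeg (msize f) f) //.
apply: inJ_sum => d _; apply: (@homog_I_inJ d); first exact: pihomogP.
apply: functional_extensionality => v; rewrite pihomogE act_sum /=.
under eq_bigr do rewrite actZ actX.
have [dv|dv] := boolP (mdeg v + d == 2 * n - 2)%N; last first.
  apply: big1 => m /eqP dm; rewrite Psi_deg ?mulr0 //.
  by rewrite mdegD dm.
transitivity (act f Psi v); last by rewrite If.
have -> : act f Psi v = \sum_(m <- msupp f) f@_m * Psi (v + m)%MM by [].
rewrite [RHS](bigID (fun m => mdeg m == d)) /= [X in _ = _ + X]big1 ?addr0 // => m dm.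
rewrite Psi_deg ?mulr0 // mdegD -(eqP dv).
by rewrite eqn_add2l.
Qed.

(** * Homogeneity and minimality *)

Lemma mulX_pinv_homog w : inD n.-1 w -> X * pinv w \is n.-homog.
Proof. by move=> hw; apply: homog_mulX; rewrite ?inE ?eqxx //; apply: pinv_homog. Qed.

Lemma b1_homog : homog_mx n b1.
Proof.
move=> i j; rewrite -(splitK i); case: (split i) => [a|b] /=.
  by rewrite b1_l; apply/mulX_pinv_homog/D1_inD.
rewrite b1_r; apply: rpredB; first by rewrite dhomogX /= mdeg_m2.
exact/mulX_pinv_homog/act_M2_inD.
Qed.

Lemma b2_homog : homog_mx 1 b2.
Proof.
have hX := homogX; have hY := homogY; have hZ := homogZ.
move=> i j; rewrite mxE.
by case: (split i) => ?; case: (split j) => ?;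
  rewrite ?(rpredD, rpredB, rpredN, rpredZ).
Qed.

Lemma b3_homog : homog_mx n b3.
Proof. by move=> i j; rewrite mxE; apply: b1_homog. Qed.

Lemma homog_minimal (a b d : nat) (M : 'M[S]_(a, b)) : (0 < d)%N -> homog_mx d M -> minimal_mx M.
Proof.
move=> d0 hM i j; apply: dhomog_nemf_coeff (hM i j) _.
by rewrite /= mdeg0 neq_ltn d0.
Qed.

(** * Exactness *)

(** Extension by zero to all natural numbers, the indexing used for the Hilbert-Burch complex. *)
Definition natf p (F : 'I_p -> S) (i : nat) : S := if insub i is Some o then F o else 0.

Lemma natf_ord p (F : 'I_p -> S) (o : 'I_p) : natf F o = F o.
Proof. by rewrite /natf valK. Qed.

Lemma natf_out p (F : 'I_p -> S) i : (p <= i)%N -> natf F i = 0.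
Proof. by move=> pi; rewrite /natf insubN // -leqNgt. Qed.

Lemma modx_gen1 a : modx (gen1 a) = 0.
Proof. by rewrite rmorphM /= modxX mul0r. Qed.

Lemma modx_gen2 b : modx (gen2 b) = Y ^+ b * Z ^+ (n - b).
Proof.
rewrite rmorphB rmorphM /= modxX mul0r subr0 modx_mon /=.
by rewrite (mpolyX_mon _ 0 b (n - b)) expr0 mul1r.
Qed.

Lemma sum_lo (F : 'I_n -> S) b : \sum_a F a * ((ord_lo a == b)%:R *: Y) = Y * natf F b.
Proof.
have [bn|nb] := ltnP b n; last first.
  rewrite natf_out // mulr0 big1 // => a _.
  have /negPf-> : ord_lo a != b by apply: contraTneq nb => <-; rewrite -ltnNge /=; apply: ltn_ord.
  by rewrite scale0r mulr0.
have eb : b = ord_lo (Ordinal bn) by apply: val_inj.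
rewrite [X in natf F X](congr1 val eb) /= -[X in natf F X]/(val (Ordinal bn)) natf_ord.
rewrite (bigD1 (Ordinal bn)) //= big1 => [|a na].
  by rewrite -eb eqxx scale1r addr0 mulrC.
have /negPf-> : ord_lo a != b.
  by apply: contra na => /eqP ab; apply/eqP/val_inj; rewrite /= -ab.
by rewrite scale0r mulr0.
Qed.

Lemma sum_hi (F : 'I_n -> S) b : \sum_a F a * ((ord_hi a == b)%:R *: Z) = Z * shift (natf F) b.
Proof.
case: (unliftP ord0 b) => [a'|] ->; last first.
  rewrite [shift _ _]/= mulr0 big1 // => a _.
  have /negPf-> : ord_hi a != ord0 by rewrite eq_sym neq_lift.
  by rewrite scale0r mulr0.
rewrite [shift _ _]natf_ord (bigD1 a') //= big1 => [|a na].
  by rewrite eqxx scale1r addr0 mulrC.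
have /negPf-> : ord_hi a != lift ord0 a' by apply: contra na => /eqP/lift_inj->.
by rewrite scale0r mulr0.
Qed.

Lemma mxBE p q (A B : 'M[S]_(p, q)) i j : (A - B) i j = A i j - B i j.
Proof. by rewrite !mxE. Qed.

Lemma mxZE p q f (A : 'M[S]_(p, q)) i j : (f *: A) i j = f * A i j.
Proof. by rewrite mxE. Qed.

Lemma row_mul_split q (v : 'rV[S]_(n + n.+1)) (M : 'M[S]_(n + n.+1, q)) j :
  (v *m M) 0 j = \sum_a v 0 (lshift _ a) * M (lshift _ a) j
               + \sum_b v 0 (rshift _ b) * M (rshift _ b) j.
Proof. by rewrite mxE big_split_ord. Qed.

Lemma modx_b1 (v : 'rV[S]_(n + n.+1)) : modx ((v *m b1) 0 0) =
  \sum_b modx (v 0 (rshift _ b)) * (Y ^+ b * Z ^+ (n - b)).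
Proof.
rewrite row_mul_split rmorphD /= !rmorph_sum /= big1 ?add0r => [|a _].
  by apply: eq_bigr => b _; rewrite rmorphM /= b1_r modx_gen2.
by rewrite rmorphM /= b1_l modx_gen1 mulr0.
Qed.

(** Only the Koszul terms survive modulo x: this block is the Hilbert-Burch matrix, and [modx_b2_l]
    gives minus its transpose. *)
Lemma modx_b2_r (v : 'rV[S]_(n + n.+1)) b : modx ((v *m b2) 0 (rshift _ b)) =
  Y * natf (fun a => modx (v 0 (lshift _ a))) b
  - Z * shift (natf (fun a => modx (v 0 (lshift _ a)))) b.
Proof.
rewrite row_mul_split rmorphD /= !rmorph_sum /= [X in _ + X]big1 ?addr0 => [|d _].
  rewrite -sum_lo -sum_hi -sumrB; apply: eq_bigr => a _.
  by rewrite rmorphM b2_lr rmorphB rmorphD /= !linearZ /= modxX modxY modxZ scaler0 add0r scalerN mulrBr.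
by rewrite rmorphM b2_rr /= linearZ /= modxX scaler0 mulr0.
Qed.

Lemma modx_b2_l (v : 'rV[S]_(n + n.+1)) c : modx ((v *m b2) 0 (lshift _ c)) =
  Z * modx (v 0 (rshift _ (ord_hi c))) - Y * modx (v 0 (rshift _ (ord_lo c))).
Proof.
rewrite row_mul_split rmorphD /= !rmorph_sum /= big1 ?add0r => [|a _].
  rewrite -(sum_delta_hi (fun b => modx (v 0 (rshift _ b)))).
  rewrite -(sum_delta_lo (fun b => modx (v 0 (rshift _ b)))).
  rewrite !mulr_sumr -sumrB; apply: eq_bigr => b _.
  rewrite rmorphM b2_rl rmorphD rmorphB /= !linearZ /= modxX modxY modxZ scaler0 add0r.
  by rewrite -!mul_mpolyC; ring.
by rewrite rmorphM b2_ll /= linearZ /= modxX scaler0 mulr0.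
Qed.

Lemma modx_b3_l a : modx (b3 0 (lshift _ a)) = 0.
Proof. by rewrite mxE b1_l modx_gen1. Qed.

Lemma modx_b3_r b : modx (b3 0 (rshift _ b)) = Y ^+ b * Z ^+ (n - b).
Proof. by rewrite mxE b1_r modx_gen2. Qed.

Definition bounded (e : nat) p (v : 'rV[S]_p) := forall i, (msize (v 0%R i) <= e)%N.

Lemma bounded0 p (v : 'rV[S]_p) : bounded 0 v -> v = 0.
Proof.
move=> H; apply/rowP => i; rewrite [RHS]mxE; apply/eqP.
by rewrite -msize_poly_eq0 -leqn0 H.
Qed.

Lemma bounded_b2 e (w : 'rV[S]_(n + n.+1)) : bounded e w -> bounded e.+1 (w *m b2).
Proof.
move=> H i; rewrite mxE; apply: msize_le_sum => j _; rewrite -(addn1 e).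
by apply: msize_leM (H _) _; apply: homog_msize_le; apply: b2_homog.
Qed.

Lemma divX_row e p (v : 'rV[S]_p) : bounded e.+1 v -> (forall i, modx (v 0 i) = 0) ->
  exists2 u, v = X *: u & bounded e u.
Proof.
move=> Hv H; have /fin_all_exists[g Hg] : forall i, exists g, v 0 i = X * g.
  by move=> i; apply: modx_eq0.
exists (\row_i g i) => [|i]; first by apply/rowP => i; rewrite !mxE.
by rewrite mxE -(@msize_mulXY _ xm) ?inE ?eqxx // -Hg.
Qed.

Lemma scaleX_eq0 p q (M : 'M[S]_(p, q)) : X *: M = 0 -> M = 0.
Proof.
move=> H; apply/matrixP => i j; have := congr1 (fun M : 'M_(_, _) => M i j) H.
by rewrite !mxE => /eqP; rewrite mulf_eq0 (negPf (mpolyX_neq0 _ _)) => /eqP.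
Qed.

(** Induction on the size bound. Modulo x the first block vanishes by [hb_inj] and the second is a
    multiple of [b3] by [hb_dual_ker]; the difference is x times a smaller cycle. *)
Lemma ker_b2 e (v : 'rV[S]_(n + n.+1)) : bounded e v -> v *m b2 = 0 ->
  exists f, v = f *: b3.
Proof.
elim: e v => [|e IH] v Hv Kv.
  by exists 0; rewrite (bounded0 Hv) scale0r.
have vl a : modx (v 0 (lshift _ a)) = 0.
  rewrite -(natf_ord (fun a => modx (v 0 (lshift _ a)))).
  apply: (@hb_inj _ n) => [b bn|]; last exact: ltnW.
  apply/eqP; rewrite -subr_eq0; apply/eqP.
  have := modx_b2_r v (Ordinal (bn : (b < n.+1)%N)).
  by rewrite Kv mxE rmorph0 => <-.
pose FR := natf (fun b => modx (v 0 (rshift _ b))).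
have [a an|f Hf] := @hb_dual_ker k n FR.
  have := modx_b2_l v (Ordinal an); rewrite Kv mxE rmorph0.
  have -> : FR a = modx (v 0 (rshift n (ord_lo (Ordinal an)))).
    by rewrite -[a]/(ord_lo (Ordinal an) : nat) /FR natf_ord.
  have -> : FR a.+1 = modx (v 0 (rshift n (ord_hi (Ordinal an)))).
    by rewrite -[a.+1]/(ord_hi (Ordinal an) : nat) /FR natf_ord.
  by move/esym/eqP; rewrite subr_eq0 => /eqP.
have vr b : modx (v 0 (rshift _ b)) = modx f * (Y ^+ b * Z ^+ (n - b)).
  rewrite -modx_id; have <- : FR b = modx (v 0 (rshift n b)) by rewrite /FR natf_ord.
  by rewrite Hf ?leq_ord // !rmorphM !rmorphXn /= modxY modxZ.
(* The entry of index 0 reduces to [modx f * Z ^+ n], so [modx f] has size at most [e.+1 - n] unless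
   it is zero, while the entries of [b3] have degree [n]. *)
have sc i : (msize (modx f * b3 0%R i) <= e.+1)%N.
  have [->|f0] := eqVneq (modx f) 0; first by rewrite mul0r msize0.
  have : (msize (modx f * (Y ^+ 0 * Z ^+ (n - 0))) <= e.+1)%N.
    by have := vr ord0 => /= <-; apply: msize_modx.
  rewrite expr0 mul1r subn0 expZ_mon msizeM ?mpolyX_neq0 // msizeX mdeg_mon !add0n addnS /=.
  have := @msize_leM k (modx f) (b3 0 i) (msize (modx f)) n (leqnn _).
  have -> : (msize (b3 0%R i) <= n.+1)%N by apply/homog_msize_le/b3_homog.
  by move=> /(_ isT) /leq_trans; apply.
have [i|i|u Eu Hu] := @divX_row e _ (v - modx f *: b3).
- rewrite mxBE mxZE.
  exact: msize_leB (Hv i) (sc i).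
- rewrite mxBE mxZE rmorphB rmorphM /= modx_id.
  rewrite -(splitK i); case: (split i) => [a|b] /=.
    by rewrite modx_b3_l vl mulr0 subrr.
  by rewrite modx_b3_r vr subrr.
have [|f' Ef'] := IH u Hu.
  apply: scaleX_eq0; rewrite scalemxAl -Eu mulmxBl Kv -scalemxAl b3_b2.
  by rewrite scaler0 subrr.
exists (modx f + X * f').
by rewrite scalerDl -scalerA -Ef' -Eu addrC subrK.
Qed.

Lemma ker_b1 e (v : 'rV[S]_(n + n.+1)) : bounded e v -> v *m b1 = 0 ->
  exists w : 'rV[S]_(n + n.+1), v = w *m b2.
Proof.
elim: e v => [|e IH] v Hv Kv.
  by exists 0; rewrite (bounded0 Hv) mul0mx.
pose FR := natf (fun b => modx (v 0 (rshift _ b))).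
have FRE b : FR b = modx (v 0 (rshift _ b)) by rewrite /FR natf_ord.
have [b bn||g [gs g0 gE]] := @hb_exact k n e FR.
- by have := FRE (Ordinal (bn : (b < n.+1)%N)) => /= ->; apply: msize_modx.
- under eq_bigr do rewrite FRE.
  by rewrite -modx_b1 Kv mxE rmorph0.
(* [w1] corrects the second block modulo x and [w2] the first; [w2] has no first block, so it leaves
   the second undisturbed modulo x. *)
pose w1 : 'rV[S]_(n + n.+1) := \row_i (if split i is inl a then g a else 0).
have w1l a : w1 0 (lshift _ a) = g a by rewrite mxE split_l.
have w1s : bounded e w1 by move=> i; rewrite mxE; case: (split i) => *; rewrite ?msize0.
pose v1 := v - w1 *m b2.
have v1s : bounded e.+1 v1.
  move=> i; rewrite mxBE; apply: msize_leB => //; exact: bounded_b2.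
have v1r b : modx (v1 0 (rshift _ b)) = 0.
  rewrite mxBE rmorphB /= modx_b2_r -modx_id -FRE gE ?leq_ord //.
  have E i : natf (fun a => modx (w1 0 (lshift _ a))) i = modx (g i).
    have [ni|ni] := leqP n i; first by rewrite natf_out // g0 // rmorph0.
    by rewrite -[i]/(Ordinal ni : nat) natf_ord w1l.
  rewrite E rmorphB !rmorphM /= modxY modxZ.
  have -> : modx (shift g b) = shift (natf (fun a => modx (w1 0 (lshift _ a)))) b.
    by case: (nat_of_ord b) => [|b'] /=; rewrite ?rmorph0 // E.
  by rewrite subrr.
have Kv1 : v1 *m b1 = 0 by rewrite mulmxBl Kv -mulmxA b2_b1 mulmx0 subrr.
have /fin_all_exists[u Hu] : forall b, exists h, v1 0 (rshift _ b) = X * h.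
  by move=> b; apply: modx_eq0.
(* The relation divided by x. Applied to [Psi] it loses the [gen2] terms and turns each
   [pinv (D1 a)] into [D1 a], which yields the solvability condition for the dual complex. *)
have E0 : \sum_a v1 0 (lshift _ a) * pinv (D1 a) + \sum_b u b * gen2 b = 0.
  apply: (@mul_mpolyX_inj k xm); rewrite /= mulr0.
  transitivity ((v1 *m b1) 0 0); last by rewrite Kv1 mxE.
  rewrite row_mul_split mulrDr !mulr_sumr; congr (_ + _); apply: eq_bigr => i _.
    by rewrite b1_l /gen1; ring.
  by rewrite b1_r Hu mulrA.
have E1 m : \sum_a act (v1 0 (lshift _ a)) (D1 a) m = 0.
  have := congr1 (fun f => act f Psi m) E0; rewrite act0 actD !act_sum.
  rewrite [X in _ + X]big1 ?addr0 => [H|b _].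
    by rewrite -[RHS]H; apply: eq_bigr => a _; rewrite actM act_pinv //; apply: D1_inD.
  by rewrite actM act_gen2 act0r.
pose f := natf (fun a => modx (v1 0 (lshift _ a))).
have fE a : f a = modx (v1 0 (lshift _ a)) by rewrite /f natf_ord.
have fs (a : nat) : (a < n)%N -> (msize (f a) <= e.+1)%N.
  by move=> an; have := fE (Ordinal an) => /= ->; apply: msize_modx.
pose s := \sum_(a < n) f a * (Y ^+ (n - a.+1) * Z ^+ a).
have sE : s = modx (\sum_(a < n) 'X_[mon 0 (n - a.+1) a] * v1 0 (lshift _ a)).
  rewrite rmorph_sum; apply: eq_bigr => a _; rewrite fE rmorphM /= modx_mon /=.
  by rewrite (mpolyX_mon _ 0 (n - a.+1) a) expr0 mul1r mulrC.
have [||w0 [wn [w0s wns Es]]] := @split_yz k n e s.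
- apply: msize_le_sum => a _.
  have -> : (e + n)%N = (e.+1 + n.-1)%N by lia.
  apply: msize_leM; first exact: fs (ltn_ord a).
  have -> : Y ^+ (n - a.+1) * Z ^+ a = 'X_[mon 0 (n - a.+1) a] :> S.
    by rewrite (mpolyX_mon _ 0 (n - a.+1) a) expr0 mul1r.
  by rewrite msizeX mdeg_mon; have := ltn_ord a; lia.
- move=> i j l jn ln; rewrite sE mcoeff_modx; case: eqP => // ->.
  (* The coefficient of [s] at y^j z^l is the value of [E1] at the complementary monomial with
     exponents n-1-j and n-1-l, which exists exactly for j, l below n. *)
  rewrite raddf_sum /= -[RHS](E1 (mon 0 (n.-1 - j) (n.-1 - l))); apply: eq_bigr => a _.
  rewrite mcoeffXM_if act_dualm !mon_sub !mon_le /=.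
  have an := ltn_ord a.
  have -> : (n - a.+1 <= j)%N && (a <= l)%N = (n.-1 - j <= a)%N && (n.-1 - l <= n.-1 - a)%N by lia.
  case: ifP => // H; congr (_@_ _); apply/eqP; rewrite mon_eq; lia.
have [g2 [g2s _ g2E]] := hb_dual_solve fs w0s wns Es.
pose w2 : 'rV[S]_(n + n.+1) := \row_i (if split i is inr b then - g2 b else 0).
have w2l a : w2 0 (lshift _ a) = 0 by rewrite mxE split_l.
have w2r b : w2 0 (rshift _ b) = - g2 b by rewrite mxE split_r.
have w2s : bounded e w2.
  by move=> i; rewrite mxE; case: (split i) => *; rewrite ?msize0 // msizeN.
have [i|i|u' Eu' Hu'] := @divX_row e _ (v1 - w2 *m b2).
- rewrite mxBE; apply: msize_leB => //; exact: bounded_b2.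
- rewrite mxBE rmorphB /= -(splitK i); case: (split i) => [a|b] /=.
    rewrite modx_b2_l !w2r -modx_id -fE g2E // [nat_of_ord (ord_hi a)]lift0.
    by rewrite rmorphB !rmorphM !rmorphN /= modxY modxZ; ring.
  rewrite v1r modx_b2_r.
  have E i' : natf (fun a => modx (w2 0 (lshift _ a))) i' = 0.
    rewrite /natf; case: insub => // a; by rewrite w2l rmorph0.
  rewrite E; have -> : shift (natf (fun a => modx (w2 0 (lshift _ a)))) b = 0.
    by case: (nat_of_ord b).
  by rewrite !mulr0 !subrr.
have [|w Ew] := IH u' Hu'.
  apply: scaleX_eq0; rewrite scalemxAl -Eu' mulmxBl Kv1 -mulmxA b2_b1.
  by rewrite mulmx0 subrr.
exists (w1 + w2 + X *: w).
by rewrite !mulmxDl -scalemxAl -Ew -Eu' -addrA [w2 *m b2 + _]addrC subrK /v1 addrC subrK.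
Qed.

Lemma bounded_ex p (v : 'rV[S]_p) : exists e, bounded e v.
Proof. by exists (\max_i msize (v 0%R i)) => i; apply: (leq_bigmax i). Qed.

(** The ring is a domain, and one entry of [b3] reduces to the nonzero z^n modulo x. *)
Lemma b3_inj (v : 'rV[S]_1) : v *m b3 = 0 -> v = 0.
Proof.
move=> H; apply/matrixP => i j; rewrite !ord1 [RHS]mxE.
have := congr1 (fun M : 'M_(_, _) => M 0 (rshift _ ord0)) H; rewrite !mxE big_ord1 => /eqP.
rewrite mulf_eq0 => /orP[/eqP//|/eqP E].
have := modx_b3_r ord0; rewrite E rmorph0 expr0 mul1r expZ_mon => /esym/eqP.
by rewrite (negPf (mpolyX_neq0 _ _)).
Qed.

Lemma exact_b3_b2 : exact_at b3 b2.
Proof.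
split=> [|v Kv]; first exact: b3_b2.
have [e Hv] := bounded_ex v; have [f ->] := ker_b2 Hv Kv.
by exists f%:M; rewrite mul_scalar_mx.
Qed.

Lemma exact_b2_b1 : exact_at b2 b1.
Proof.
split=> [|v Kv]; first exact: b2_b1.
by have [e Hv] := bounded_ex v; apply: ker_b1 Hv Kv.
Qed.
End Main.

Theorem theorem3p6 (k : fieldType) (n : nat) (Phi : 'X_{1..3} -> k)
  (pinv : ('X_{1..3} -> k) -> {mpoly k[3]}) :
  (0 < n)%N ->
  (* Phi lies in D_{2n-1} U^* *)
  inD (2 * n - 1) Phi ->
  (* p : Sym_{n-1} U -> D_{n-1} U^* is an isomorphism with inverse pinv *)
  (forall mu, mu \is (n.-1).-homog -> pinv (pmapx Phi mu) = mu) ->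
  (forall w, inD n.-1 w -> pinv w \is (n.-1).-homog /\ pmapx Phi (pinv w) =1 w) ->
  [/\ (* b3 injective *)
      (forall v : 'rV[{mpoly k[3]}]_1, v *m b3mx n Phi pinv = 0 -> v = 0),
      (* exactness at B2 and B1 *)
      exact_at (b3mx n Phi pinv) (b2mx n Phi pinv),
      exact_at (b2mx n Phi pinv) (b1mx n Phi pinv),
      (* coker b1 = R/I, i.e. image of b1 = I *)
      (forall f : {mpoly k[3]},
         inI Phi f <-> exists v : 'rV[{mpoly k[3]}]_(n + n.+1), f = (v *m b1mx n Phi pinv) 0 0)
    & ((* homogeneous, with graded form
          0 -> R(-2n-1) -> R(-n-1)^{2n+1} -> R(-n)^{2n+1} -> R *)
       [/\ homog_mx n (b1mx n Phi pinv), homog_mx 1 (b2mx n Phi pinv)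
          & homog_mx n (b3mx n Phi pinv)] /\
       (* minimal *)
       [/\ minimal_mx (b1mx n Phi pinv), minimal_mx (b2mx n Phi pinv)
          & minimal_mx (b3mx n Phi pinv)])].
Proof.
move=> n0 hPhi hK hP; split.
- exact: b3_inj.
- exact: exact_b3_b2.
- exact: exact_b2_b1.
- exact: inI_inJ.
have h1 : homog_mx n (b1mx n Phi pinv) by apply: b1_homog.
have h2 : homog_mx 1 (b2mx n Phi pinv) by apply: b2_homog.
have h3 : homog_mx n (b3mx n Phi pinv) by apply: b3_homog.
by split; split=> //; [exact: homog_minimal h1|exact: homog_minimal h2|exact: homog_minimal h3].
Qed.
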